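(* Let $A$ and $B$ be two propositions. If (i) $A \models_4 B$, or (ii) $\models_2 \neg A \wedge B$, then for all $n \in (0,1]$, $\langle A \geq n\rangle \mathrel{|\!\!\!\approx} \langle B \geq n\rangle$.
   Context: Propositions are built from propositional letters with $\wedge,\vee,\neg$ (the logical constants $\top,\bot$ do not occur in them). Fuzzy semantics: a fuzzy interpretation $\mathcal I$ maps each letter $p$ to $p^{\mathcal I}\in[0,1]$ and is extended by $(\neg A)^{\mathcal I}=1-A^{\mathcal I}$, $(A\wedge B)^{\mathcal I}=\min\{A^{\mathcal I},B^{\mathcal I}\}$, $(A\vee B)^{\mathcal I}=\max\{A^{\mathcal I},B^{\mathcal I}\}$. For $n\in[0,1]$, $\mathcal I$ satisfies $\langle A\geq n\rangle$ iff $A^{\mathcal I}\geq n$. We write $\langle A \geq n\rangle \mathrel{|\!\!\!\approx} \langle B \geq n\rangle$ if every fuzzy interpretation satisfying $\langle A\geq n\rangle$ satisfies $\langle B\geq n\rangle$. Four-valued semantics: a four-valued interpretation $\mathcal I$ maps each proposition to a subset of $\{t,f\}$ such that: $t\in(A\wedge B)^{\mathcal I}$ iff $t\in A^{\mathcal I}$ and $t\in B^{\mathcal I}$; $f\in(A\wedge B)^{\mathcal I}$ iff $f\in A^{\mathcal I}$ or $f\in B^{\mathcal I}$; $t\in(A\vee B)^{\mathcal I}$ iff $t\in A^{\mathcal I}$ or $t\in B^{\mathcal I}$; $f\in(A\vee B)^{\mathcal I}$ iff $f\in A^{\mathcal I}$ and $f\in B^{\mathcal I}$; $t\in(\neg A)^{\mathcal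 I}$ iff $f\in A^{\mathcal I}$; $f\in(\neg A)^{\mathcal I}$ iff $t\in A^{\mathcal I}$. $A\models_4 B$ means: for every four-valued interpretation $\mathcal I$, $t\in A^{\mathcal I}$ implies $t\in B^{\mathcal I}$. $\models_2$ is classical two-valued entailment; $\models_2 C$ means $C$ is a classical tautology. *)

(* Defs.v *)
From mathcomp Require Import all_boot all_order all_algebra.
From mathcomp Require Import reals.

Set Implicit Arguments.
Unset Strict Implicit.
Unset Printing Implicit Defensive.

Import Order.TTheory GRing.Theory Num.Theory.

Local Open Scope ring_scope.

(* The set [L] of propositional letters is arbitrary. *)
Inductive proposition (L : Type) : Type :=
| Letter of L
| Neg of proposition L
| Conj of proposition L & proposition L
| Disj of proposition L & proposition L.

Record fuzzy_interp (R : realType) (L : Type) := FuzzyInterp {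
  fuzzy_letter :> L -> R;
  fuzzy_letter_itv : forall p, 0 <= fuzzy_letter p <= 1
}.

Fixpoint fuzzy_val (R : realType) (L : Type) (I : fuzzy_interp R L)
    (A : proposition L) : R :=
  match A with
  | Letter p => I p
  | Neg A1 => 1 - fuzzy_val I A1
  | Conj A1 A2 => Num.min (fuzzy_val I A1) (fuzzy_val I A2)
  | Disj A1 A2 => Num.max (fuzzy_val I A1) (fuzzy_val I A2)
  end.

(* [FuzzyGe A n] is the fuzzy proposition <A >= n>. *)
Inductive fuzzy_prop (R : realType) (L : Type) := FuzzyGe of proposition L & R.

Definition fuzzy_sat (R : realType) (L : Type) (I : fuzzy_interp R L)
    (phi : fuzzy_prop R L) : Prop :=
  let: FuzzyGe A n := phi in n <= fuzzy_val I A.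

Definition fuzzy_entails (R : realType) (L : Type)
    (phi psi : fuzzy_prop R L) : Prop :=
  forall I : fuzzy_interp R L, fuzzy_sat I phi -> fuzzy_sat I psi.

(* Subsets of {t, f} are elements of [{set bool}], with [true] for t and
   [false] for f.  An interpretation acts on all propositions, not only on
   letters; the equations below are between booleans, i.e. equivalences. *)
Record four_interp (L : Type) := FourInterp {
  four_val :> proposition L -> {set bool};
  four_conj_t : forall A B,
    (true \in four_val (Conj A B))
      = (true \in four_val A) && (true \in four_val B);
  four_conj_f : forall A B,
    (false \in four_val (Conj A B))
      = (false \in four_val A) || (false \in four_val B);
  four_disj_t : forall A B,
    (true \in four_val (Disj A B))
      = (true \in four_val A) || (true \in four_val B);
  four_disj_f : forall A B,
    (false \in four_val (Disj A B))
      = (false \in four_val A) && (false \in four_val B);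
  four_neg_t : forall A,
    (true \in four_val (Neg A)) = (false \in four_val A);
  four_neg_f : forall A,
    (false \in four_val (Neg A)) = (true \in four_val A)
}.

Definition four_entails (L : Type) (A B : proposition L) : Prop :=
  forall I : four_interp L, true \in I A -> true \in I B.

Fixpoint classical_val (L : Type) (v : L -> bool) (A : proposition L) : bool :=
  match A with
  | Letter p => v p
  | Neg A1 => ~~ classical_val v A1
  | Conj A1 A2 => classical_val v A1 && classical_val v A2
  | Disj A1 A2 => classical_val v A1 || classical_val v A2
  end.

Definition classical_tautology (L : Type) (A : proposition L) : Prop :=
  forall v : L -> bool, classical_val v A.

(* Main.v *)
(** If [A] entails [B] four-valuedly, apply this to the four-valued
    interpretation in which [t] holds of [C] when [n <= C^I] and [f] holds of
    [C] when [n <= (~ C)^I]. If [~ A /\ B] is a tautology, compare the fuzzy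
    interpretation with a two-valued one that rounds the value of every letter
    at 1/2: it gives [A^I <= 1/2 <= B^I]. *)
Require Import Defs.
From mathcomp Require Import all_boot all_order all_algebra.
From mathcomp Require Import reals.
From mathcomp Require Import lra.

Set Implicit Arguments.
Unset Strict Implicit.
Unset Printing Implicit Defensive.

Import Order.TTheory GRing.Theory Num.Theory.

Local Open Scope ring_scope.

(** A proposition may get both truth values when [n <= 1/2] and neither when [n > 1/2], hence four
    values. *)
Definition threshold_val (R : realType) (L : Type) (I : fuzzy_interp R L)
    (n : R) (A : proposition L) : {set bool} :=
  [set b | n <= fuzzy_val I (if b then A else Neg A)].

Lemma le_subr_min (R : realDomainType) (n x y : R) :
  (n <= 1 - Num.min x y) = (n <= 1 - x) || (n <= 1 - y).
Proof. by rewrite lerBrDl -lerBrDr ge_min ![_ <= 1 - n]lerBrDr -!lerBrDl. Qed.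

Lemma le_subr_max (R : realDomainType) (n x y : R) :
  (n <= 1 - Num.max x y) = (n <= 1 - x) && (n <= 1 - y).
Proof. by rewrite lerBrDl -lerBrDr ge_max ![_ <= 1 - n]lerBrDr -!lerBrDl. Qed.

Definition threshold_interp (R : realType) (L : Type) (I : fuzzy_interp R L)
  (n : R) : four_interp L.
Proof.
apply: (@FourInterp L (threshold_val I n)) => *; rewrite !inE /=.
- by rewrite le_min.
- by rewrite le_subr_min.
- by rewrite le_max.
- by rewrite le_subr_max.
- by [].
- by rewrite subKr.
Defined.

(** Both bounds are weak because negation fixes 1/2: a letter of value 1/2 rounds to false and its
    negation to true. *)
Lemma classical_val_round (R : realType) (L : Type) (I : fuzzy_interp R L)
    (A : proposition L) :
  let b := classical_val (fun p => 1 / 2 < I p) A in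
  if b then 1 / 2 <= fuzzy_val I A else fuzzy_val I A <= 1 / 2.
Proof.
elim: A => [p|A IHA|A IHA B IHB|A IHA B IHB] /=.
- by case: ltP => // /ltW.
- by move: IHA; case: classical_val => /=; lra.
- by move: IHA IHB; do 2!case: classical_val => /=;
    rewrite ?le_min ?ge_min => leA leB; rewrite ?leA ?leB ?orbT.
- by move: IHA IHB; do 2!case: classical_val => /=;
    rewrite ?le_max ?ge_max => leA leB; rewrite ?leA ?leB ?orbT.
Qed.

Theorem proposition4p1 (R : realType) (L : Type) (A B : proposition L) :
  four_entails A B \/ classical_tautology (Conj (Neg A) B) ->
  forall n : R, 0 < n <= 1 ->
    fuzzy_entails (FuzzyGe A n) (FuzzyGe B n).
Proof.
move=> [entAB | tautAB] n _ I /= leA.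
  by have := entAB (threshold_interp I n); rewrite /= !inE; apply.
have := tautAB (fun p => 1 / 2 < I p).
move: (classical_val_round I A) (classical_val_round I B) => /=.
(* The tautology leaves only the case where [A] rounds to false and [B] to true. *)
case: classical_val => //; case: classical_val => // leA2 leB2 _.
exact: le_trans leA (le_trans leA2 leB2).
Qed.
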